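(* Let $R$ be a ring with center $C(R)$, let $a, b\in C(R)$, and let $g(x) \in (x-a)(x-b)C(R)[x]$. Then the following hold: (1) $R$ is strongly $(x-a)(x-b)$-clean if and only if $R$ is strongly clean and $b-a \in U(R)$. (2) If $R$ is strongly clean and $b-a \in U(R)$, then $R$ is strongly $g(x)$-clean.
   Context: Rings are associative with identity (not necessarily commutative). $U(R)$ denotes the group of units of $R$ and $C(R)$ the center of $R$. For $g(x)\in C(R)[x]$, the ring $R$ is called strongly $g(x)$-clean if every $r\in R$ can be written as $r=s+u$ with $s\in R$, $g(s)=0$, $u\in U(R)$, and $su=us$. $R$ is called strongly clean if every $r\in R$ can be written as $r=e+u$ with $e^2=e\in R$, $u\in U(R)$, and $eu=ue$. *)

(* Defs.v *)
From mathcomp Require Import all_boot all_algebra.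

Set Implicit Arguments.
Unset Strict Implicit.
Unset Printing Implicit Defensive.

Import GRing.Theory.
Local Open Scope ring_scope.

(* Rings are nzRingType, i.e. 1 != 0 as everywhere in the theory of {poly R}. *)

Definition central (R : nzRingType) (c : R) : Prop :=
  forall r : R, GRing.comm c r.

(* Stated directly because GRing.unit requires a unitRingType, i.e. a ring
   equipped with an inverse operation; by unitrP the two notions agree there. *)
Definition invertible (R : nzRingType) (u : R) : Prop :=
  exists v : R, v * u = 1 /\ u * v = 1.

(* C(R)[x], as a subset of R[x]. *)
Definition central_poly (R : nzRingType) (g : {poly R}) : Prop :=
  forall i : nat, central g`_i.

(* Meant for g in C(R)[x]: the value g.[s] then does not depend on the side on
   which the coefficients are written. *)
Definition strongly_poly_clean (R : nzRingType) (g : {poly R}) : Prop :=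
  forall r : R, exists s u : R,
    [/\ r = s + u, g.[s] = 0, invertible u & s * u = u * s].

Definition strongly_clean (R : nzRingType) : Prop :=
  forall r : R, exists e u : R,
    [/\ r = e + u, e ^+ 2 = e, invertible u & e * u = u * e].

(* Main.v *)
Require Import Defs.
From mathcomp Require Import all_boot all_algebra.

Import GRing.Theory.
Local Open Scope ring_scope.

(** Write c = b - a.  When c is invertible, the central affine bijection
    e |-> a + c e of R carries the roots of x (x - 1), that is the idempotents,
    to the roots of (x - a) (x - b), because
    (a + c e - a) (a + c e - b) = c ^ 2 (e ^ 2 - e).  It multiplies differences
    by the central unit c, hence it carries decompositions r = e + u into an
    idempotent and a commuting unit to decompositions
    a + c r = (a + c e) + c u into a root and a commuting unit, and conversely.
    This exchanges the two notions of cleanness as soon as c is invertible, and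
    roots of (x - a) (x - b) remain roots of its central multiples, by
    [horner_mul_central].

    That strong (x - a) (x - b)-cleanness forces c to be invertible follows
    from decomposing a itself: if a = s + u then s - a = - u is invertible, so
    (s - a) (s - b) = 0 gives s = b and c = - u ([sub_invertible]). *)

Section Central.

Variable R : nzRingType.
Implicit Types a b c d e r s u : R.

Lemma centralB a b : central a -> central b -> central (a - b).
Proof. by move=> ha hb r; apply/commr_sym/commrB; apply/commr_sym. Qed.

Lemma central_inv c d : central c -> d * c = 1 -> c * d = 1 -> central d.
Proof.
move=> hc dc cd r; rewrite /GRing.comm.
by rewrite -[d * r]mulr1 -cd mulrA -(mulrA d r c) -hc mulrA dc mul1r.
Qed.

Lemma invertibleN u : invertible u -> invertible (- u).
Proof. by case=> v [vu uv]; exists (- v); rewrite !mulrNN. Qed.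

Lemma invertibleM u v : invertible u -> invertible v -> invertible (u * v).
Proof.
move=> [u' [u'u uu']] [v' [v'v vv']]; exists (v' * u'); split.
  by rewrite mulrA -(mulrA v') u'u mulr1.
by rewrite mulrA -(mulrA u) vv' mulr1.
Qed.

(** Only the right factor has to have central coefficients, since evaluation
    puts the coefficients on the left. *)
Lemma horner_mul_central (p q : {poly R}) s :
  central_poly q -> (p * q).[s] = p.[s] * q.[s].
Proof. by move=> hq; apply/hornerM_comm/comm_coef_poly => i; apply: hq. Qed.

Lemma horner_XsubC_mul a b s :
  central b -> (('X - a%:P) * ('X - b%:P)).[s] = (s - a) * (s - b).
Proof.
move=> hb; rewrite hornerM_comm ?hornerXsubC //.
by rewrite /comm_poly hornerXsubC mulrBr mulrBl hb.
Qed.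

(** The image a + (b - a) e of an idempotent is a root of (x - a) (x - b). *)
Lemma root_of_idempotent a b e : central (b - a) -> e ^+ 2 = e ->
  (a + (b - a) * e - a) * (a + (b - a) * e - b) = 0.
Proof.
move=> hc ee.
have -> : a + (b - a) * e - b = (b - a) * e - (b - a).
  by rewrite opprB [RHS]addrC addrAC.
rewrite [a + _]addrC addrK mulrBr -(mulrA _ e (b - a)) -(hc e) -mulrA.
by rewrite (mulrA e) -(hc e) -(mulrA (b - a) e e) -expr2 ee subrr.
Qed.

(** The inverse affine map: d stands for the inverse of b - a. *)
Lemma idempotent_of_root a b d s : central d -> d * (b - a) = 1 ->
  (s - a) * (s - b) = 0 -> (d * (s - a)) ^+ 2 = d * (s - a).
Proof.
move=> hd dc root_s.
have sq : (s - a) * (s - a) = (s - a) * (b - a).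
  by apply/eqP; rewrite -subr_eq0 -mulrBr opprB addrA subrK root_s.
rewrite expr2 mulrA -(mulrA d) -hd -!mulrA sq (mulrA d (s - a)) (hd (s - a)).
by rewrite -mulrA dc mulr1 hd.
Qed.

Lemma sub_invertible a b : central b ->
  strongly_poly_clean (('X - a%:P) * ('X - b%:P)) -> invertible (b - a).
Proof.
move=> hb /(_ a) [s [u [def_a]]]; rewrite horner_XsubC_mul // => root_s iu _.
have sa : s - a = - u by rewrite def_a opprD addrA subrr add0r.
have [v [vu _]] := invertibleN _ iu.
have /eqP : s - b = 0 by rewrite -[s - b]mul1r -vu -mulrA -sa root_s mulr0.
by rewrite subr_eq0 => /eqP <-; rewrite sa; apply: invertibleN.
Qed.

Lemma strongly_clean_of_poly a b : central a -> central b ->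
  strongly_poly_clean (('X - a%:P) * ('X - b%:P)) -> strongly_clean R.
Proof.
move=> ha hb clean r.
have [d [dc cd]] := sub_invertible _ _ hb clean.
have hd : central d := central_inv _ _ (centralB _ _ hb ha) dc cd.
have [s [u [def_r]]] := clean (a + (b - a) * r).
rewrite horner_XsubC_mul // => root_s iu su.
exists (d * (s - a)), (d * u); split.
- by rewrite -mulrDr addrAC -def_r [a + _]addrC addrK mulrA dc mul1r.
- exact: idempotent_of_root dc root_s.
- by apply: invertibleM => //; exists (b - a).
- have sau : (s - a) * u = u * (s - a) by rewrite mulrBl mulrBr su ha.
  by rewrite -!mulrA (mulrA _ d) -hd (mulrA u) -(hd u) -!mulrA sau.
Qed.

Lemma poly_clean_of_strongly a b (h : {poly R}) :
    central a -> central b -> central_poly h ->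
    strongly_clean R -> invertible (b - a) ->
  strongly_poly_clean (('X - a%:P) * ('X - b%:P) * h).
Proof.
move=> ha hb hh clean ic r; have [d [_ cd]] := ic.
have hc : central (b - a) := centralB _ _ hb ha.
have [e [u [def_r ee iu eu]]] := clean (d * (r - a)).
exists (a + (b - a) * e), ((b - a) * u); split.
- by rewrite -addrA -mulrDr -def_r mulrA cd mul1r addrC subrK.
- rewrite horner_mul_central // horner_XsubC_mul //.
  by rewrite root_of_idempotent // mul0r.
- exact: invertibleM.
- rewrite mulrDl mulrDr ha; congr (_ + _).
  by rewrite -!mulrA (mulrA e) -hc (mulrA u) -(hc u) -!mulrA eu.
Qed.

End Central.

Theorem theorem2p4 (R : nzRingType) (a b : R) (g : {poly R})
    (ha : central a) (hb : central b)
    (hg : exists h : {poly R},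
        central_poly h /\ g = ('X - a%:P) * ('X - b%:P) * h) :
  (strongly_poly_clean (('X - a%:P) * ('X - b%:P)) <->
     strongly_clean R /\ invertible (b - a)) /\
  (strongly_clean R /\ invertible (b - a) -> strongly_poly_clean g).
Proof.
split; last first.
  case: hg => h [hh ->] [clean ic].
  exact: poly_clean_of_strongly.
split=> [clean | [clean ic]].
  by split; [apply: strongly_clean_of_poly clean | apply: sub_invertible].
rewrite -[_ * _]mulr1; apply: poly_clean_of_strongly => // i r.
by rewrite coef1; apply/commr_sym/commr_nat.
Qed.
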